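(* For all integers $n \geqslant 0$, $$E_{2,n}=2(n+1)!\sum_{j=1}^{n+1}\frac{\eta(j)}{j}=2(n+1)!\Big[\log2+\sum_{j=2}^{n+1}\frac{(1-2^{1-j})\zeta(j)}{j}\Big].$$
   Context: $$E_{2,n} = (-1)^{n} \int_{(0,1]^2} \frac{h_n(\log t_1, \log t_2)}{t_1 + t_2} \, \mathrm{d}t_1\,\mathrm{d}t_2,\qquad h_n(y_1,y_2)=\sum_{a+b=n,\ a,b\geqslant0}y_1^{a}y_2^{b}\quad(h_0=1).$$ $\eta(s)=\sum_{m\geqslant1}(-1)^{m-1}m^{-s}$ is the Dirichlet eta function (so $\eta(1)=\log 2$ and $\eta(j)=(1-2^{1-j})\zeta(j)$ for integers $j\geqslant2$), and $\zeta$ is the Riemann zeta function. *)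

(* Defs.v *)
(* MathComp-Analysis *)
From mathcomp Require Export all_boot all_order all_algebra.
From mathcomp Require Export all_classical all_reals all_analysis.
Export Order.TTheory GRing.Theory Num.Theory.
Export numFieldNormedType.Exports.

Set Implicit Arguments.
Unset Strict Implicit.
Unset Printing Implicit Defensive.

Local Open Scope classical_set_scope.
Local Open Scope ring_scope.

Definition hsym (R : realType) (n : nat) (y1 y2 : R) : R :=
  \sum_(a < n.+1) \sum_(b < n.+1 | (a + b == n)%N) y1 ^+ a * y2 ^+ b.

(* The integrand has the constant sign of (-1) ^ n on the square since both
   logarithms are nonpositive there, so an equality of E2 with a finite value
   includes the convergence of the integral. *)
Definition E2 (R : realType) (n : nat) : \bar R :=
  (((-1) ^+ n)%:E *
   \int[(@lebesgue_measure R \x @lebesgue_measure R)%E]_(t in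
          [set` `]0%R, 1%R]] `*` [set` `]0%R, 1%R]])
     (hsym n (ln t.1) (ln t.2) / (t.1 + t.2))%:E)%E.

(* Indices are shifted by one: riemannR s m = (m + 1) ^ (- s), and the sign
   (-1) ^ m is that of the (m + 1)-th term.  The series converges for 0 < s,
   only conditionally when s <= 1. *)
Definition eta (R : realType) (s : R) : R :=
  limn (series (fun m : nat => (-1) ^+ m * riemannR s m)).

(* Meaningful for 1 < s, where the series converges. *)
Definition zeta (R : realType) (s : R) : R :=
  limn (series (riemannR s)).

(* Main.v *)
Require Import Defs.
From mathcomp Require Import measurable_realfun ring lra.

Local Open Scope classical_set_scope.
Local Open Scope ring_scope.

(** Cut the square along its diagonal.  The integrand is symmetric, so both
    triangles contribute equally, and on the triangle t2 <= t1 the rays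
    t2 = t1 * u, with 0 < u <= 1, separate the variables: the Jacobian t1
    cancels the homogeneous denominator t1 + t2 = t1 * (1 + u).  Put
    s = - ln t1 and v = - ln u, both nonnegative on the square.  The sign
    (-1) ^ n turns the numerator into h_n(s, s + v), which is the divided
    difference ((s + v) ^ (n + 1) - s ^ (n + 1)) / v, hence the sum over
    k <= n of C(n + 1, k + 1) s ^ (n - k) v ^ k (lemma [hsymDr]).  Two
    one-dimensional integrals over (0, 1] remain:
    - that of s ^ (n - k) is (n - k)! ([log_moment] with N = 0);
    - that of v ^ k / (1 + u) is k! eta(k + 1) ([eta_integralE]).
    Since C(n + 1, k + 1) k! (n - k)! = (n + 1)! / (k + 1), the first formula
    follows ([E2_eta]).

    For the eta integrals, let I_N be the integral of u ^ N v ^ k / (1 + u).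
    Then I_N + I_(N + 1) is the log-moment k! / (N + 1) ^ (k + 1), the
    denominator having cancelled, so I_0 is a partial sum of the alternating
    series plus or minus the remainder I_N, and I_N tends to 0 because the
    moment bounds it.  The series thus appears by integrating finite sums only.

    The second formula uses eta(1) = ln 2 ([eta1]) and the relation between
    eta and zeta ([eta_zeta]), which is the splitting of a partial sum of zeta
    into odd and even terms. *)

(** * Tonelli over a region, and dilations *)

(** Triangles rather than rectangles are integrated below: one of them gives
    the log-moments, and two of them make up the square. *)
Lemma tonelli_region d1 d2 (T1 : measurableType d1) (T2 : measurableType d2)
    (R : realType) (m1 : {sigma_finite_measure set T1 -> \bar R})
    (m2 : {sigma_finite_measure set T2 -> \bar R})
    (S : set (T1 * T2)) (f : T1 * T2 -> \bar R) :
  measurable S -> measurable_fun S f ->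
  (forall z, S z -> (0 <= f z)%E) ->
  forall (A : set T1) (B : T1 -> set T2),
  (forall x y, S (x, y) <-> A x /\ B x y) ->
  (\int[m1 \x m2]_(z in S) f z = \int[m1]_(x in A) \int[m2]_(y in B x) f (x, y))%E.
Proof.
move=> mS mf f0 A B SAB.
rewrite integral_mkcond fubini_tonelli1; first last.
- by move=> z; rewrite patchE; case: ifP => // /set_mem /f0.
- exact: (measurable_restrictT _ mS).1.
rewrite [RHS]integral_mkcond; apply: eq_integral => x _.
rewrite /fubini_F [RHS]patchE; case: ifPn => [/set_mem Ax|/negP Ax].
  rewrite [RHS]integral_mkcond; apply: eq_integral => y _.
  rewrite !patchE; case: ifPn => [/set_mem /SAB[_ Bxy]|/negP Sxy].
    by rewrite mem_set.
  by rewrite memNset// => Bxy; apply: Sxy; apply/mem_set/SAB.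
rewrite integral0_eq// => y _; rewrite patchE memNset// => /SAB[Ax' _].
by apply: Ax; apply/mem_set.
Qed.

Lemma tonelli_region_swap d1 d2 (T1 : measurableType d1) (T2 : measurableType d2)
    (R : realType) (m1 : {sigma_finite_measure set T1 -> \bar R})
    (m2 : {sigma_finite_measure set T2 -> \bar R})
    (S : set (T1 * T2)) (f : T1 * T2 -> \bar R) :
  measurable S -> measurable_fun S f ->
  (forall z, S z -> (0 <= f z)%E) ->
  forall (A : set T2) (B : T2 -> set T1),
  (forall x y, S (x, y) <-> A y /\ B y x) ->
  (\int[m1 \x m2]_(z in S) f z = \int[m2]_(y in A) \int[m1]_(x in B y) f (x, y))%E.
Proof.
move=> mS mf f0 A B SAB.
rewrite integral_mkcond fubini_tonelli2; first last.
- by move=> z; rewrite patchE; case: ifP => // /set_mem /f0.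
- exact: (measurable_restrictT _ mS).1.
rewrite [RHS]integral_mkcond; apply: eq_integral => y _.
rewrite /fubini_G [RHS]patchE; case: ifPn => [/set_mem Ay|/negP Ay].
  rewrite [RHS]integral_mkcond; apply: eq_integral => x _.
  rewrite !patchE; case: ifPn => [/set_mem /SAB[_ Bxy]|/negP Sxy].
    by rewrite mem_set.
  by rewrite memNset// => Bxy; apply: Sxy; apply/mem_set/SAB.
rewrite integral0_eq// => x _; rewrite patchE memNset// => /SAB[Ay' _].
by apply: Ay; apply/mem_set.
Qed.

(** Positivity is what makes the inverse a real power, whose measurability is
    known. *)
Lemma measurable_funV_pos d (T : measurableType d) (R : realType) (D : set T)
    (f : T -> R) : measurable_fun D f -> (forall x, D x -> 0 < f x) ->
  measurable_fun D (fun x => (f x)^-1).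
Proof.
move=> mf f0.
apply: (@eq_measurable_fun _ _ _ _ _ (fun x => f x `^ (-1))) => [x /set_mem Dx|].
  by rewrite powR_inv1// ltW// f0.
exact: (measurableT_comp (measurable_powR _) mf).
Qed.

(** The image of Lebesgue measure under u |-> t * u, multiplied by t, agrees with
    Lebesgue measure on half-open intervals, hence is Lebesgue measure. *)
Lemma integral_dilation (R : realType) (t : R) (f : R -> \bar R) : 0 < t ->
  measurable_fun `]0, t] f -> (forall x, 0 < x <= t -> (0 <= f x)%E) ->
  (\int[lebesgue_measure]_(y in `]0%R, t]) f y =
   t%:E * \int[lebesgue_measure]_(u in `]0%R, 1%R]) f (t * u)%R)%E.
Proof.
move=> t0 mf f0.
have mphi : measurable_fun [set: measurableTypeR R]
    (fun u : measurableTypeR R => t * u : measurableTypeR R).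
  exact: mulrl_measurable.
pose k : {nonneg R} := NngNum (ltW t0).
have -> : (`]0%R, 1%R]%classic : set R) = (fun u : R => t * u) @^-1` `]0, t].
  apply/seteqP; split => u /=; rewrite !in_itv/= => /andP[u0 u1];
    apply/andP; split.
  - by rewrite mulr_gt0.
  - by rewrite ler_piMr// ltW.
  - by move: u0; rewrite pmulr_rgt0.
  - by rewrite -(ler_pM2l t0) mulr1.
rewrite -(@ge0_integral_pushforward _ _ _ _ _ _ mphi 
  lebesgue_measure _ f)//; last first.
  by move=> y; rewrite inE/= in_itv/=; exact: f0.
rewrite -[X in (X%:E * _)%E]/(k%:num) -ge0_integral_mscale//.
apply: eq_measure_integral => /= A mA _.
apply: lebesgue_measure_unique => //=.
move=> _ [[a b]] _ <-.
have preim : (fun u => t * u) @^-1` `]a, b] = `]a / t, b / t]%classic.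
  apply/seteqP; split => u /=; rewrite !in_itv/=;
    by rewrite ltr_pdivrMr// ler_pdivlMr// mulrC.
rewrite /mscale /= /pushforward preim.
rewrite !lebesgue_measure_itv/= !lte_fin ltr_pM2r ?invr_gt0//.
case: ifP => _; last by rewrite mule0.
by rewrite -!EFinB -EFinM; congr EFin; field; rewrite gt_eqF.
Qed.

(** * Moments of the logarithm on (0, 1] *)

Section moments.
Context {R : realType}.
Local Notation mu := (@lebesgue_measure R).
Implicit Types (N m : nat) (u w t : R).

Lemma is_derive_logX m w : 0 < w ->
  is_derive w 1 (fun x : R => - (- ln x) ^+ m.+1)
    (m.+1%:R * (- ln w) ^+ m / w).
Proof.
move=> w0; have dln := is_derive1_ln w0.
have -> : (fun x : R => - (- ln x) ^+ m.+1) = - ((- @ln R) ^+ m.+1).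
  by apply/funext => x; rewrite !fctE.
apply: is_derive_eq; rewrite /GRing.scale/= fctE.
rewrite -mulr_natl; ring.
Qed.

Lemma integral_dlogX m u : 0 < u <= 1 ->
  (\int[mu]_(w in `[u, 1%R]) (m.+1%:R * (- ln w) ^+ m / w)%:E =
   ((- ln u) ^+ m.+1)%:E)%E.
Proof.
move=> /andP[u0]; rewrite le_eqVlt => /predU1P[->|u1].
  by rewrite set_itv1 integral_set1 ln1 oppr0 expr0n.
rewrite (@continuous_FTC2 _ _ (fun x : R => - (- ln x) ^+ m.+1))//.
- by rewrite ln1 oppr0 expr0n/= oppr0 add0e opprK.
- apply: continuous_in_subspaceT => w /[!inE]/=; rewrite in_itv/= => /andP[uw _].
  have w0 : 0 < w by exact: lt_le_trans uw.
  have cln := continuous_ln w0.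
  apply: cvgM; last exact: cvgV (lt0r_neq0 w0) cvg_id.
  apply: cvgM; first exact: cvg_cst.
  apply: (@continuous_comp _ _ _ (fun x : R => - ln x) (fun y => y ^+ m)).
    exact: cvgN.
  exact: exprn_continuous.
- have dF w : u <= w -> is_derive w 1 (fun x : R => - (- ln x) ^+ m.+1) 
    (m.+1%:R * (- ln w) ^+ m / w).
    by move=> uw; apply: is_derive_logX; exact: lt_le_trans uw.
  have cF w : u <= w -> {for w, continuous (fun x : R => - (- ln x) ^+ m.+1)}.
    by move=> /dF[df _]; apply/differentiable_continuous/derivable1_diffP.
  split.
  + by move=> w; rewrite in_itv/= => /andP[/ltW/dF[]].
  + exact/cvg_at_right_filter/cF.
  + by apply/cvg_at_left_filter/cF; exact: ltW.
- move=> w; rewrite in_itv/= => /andP[uw _].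
  by have [_ ] := @is_derive_logX m _ (lt_trans u0 uw); rewrite derive1E.
Qed.

Lemma integralXn N t : 0 <= t ->
  (\int[mu]_(u in `]0%R, t]) (u ^+ N)%:E = (t ^+ N.+1 / N.+1%:R)%:E)%E.
Proof.
rewrite le_eqVlt => /predU1P[<-|t0].
  by rewrite set_itvoc0// integral_set0 expr0n mul0r.
have mX : measurable_fun [set: R] (fun u : R => (u ^+ N)%:E).
  by apply/measurable_EFinP; exact: measurable_funX.
rewrite integral_itv_obnd_cbnd; last exact: measurable_funTS.
have dF u : is_derive u 1 (fun x : R => x ^+ N.+1 / N.+1%:R) (u ^+ N).
  have -> : (fun x : R => x ^+ N.+1 / N.+1%:R) = N.+1%:R^-1 \*: (@id R ^+ N.+1).
    by apply/funext => x; rewrite /= !fctE mulrC.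
  apply: is_derive_eq; rewrite /GRing.scale/= mulr1 -mulr_natl mulrA.
  by rewrite mulVf ?mul1r// pnatr_eq0.
have cF u : {for u, continuous (fun x : R => x ^+ N.+1 / N.+1%:R)}.
  by have [df _] := dF u; apply/differentiable_continuous/derivable1_diffP.
rewrite (@continuous_FTC2 _ _ (fun x : R => x ^+ N.+1 / N.+1%:R))//.
- by rewrite expr0n mul0r oppe0 adde0.
- by apply: continuous_subspaceT => u; exact: exprn_continuous.
- split; first by move=> u _; have [] := dF u.
  + exact/cvg_at_right_filter/cF.
  + exact/cvg_at_left_filter/cF.
- by move=> u _; have [_] := dF u; rewrite derive1E.
Qed.

Lemma measurable_triangle :
  measurable [set z : R * R | 0 < z.1 /\ z.1 <= z.2 /\ z.2 <= 1].
Proof.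
rewrite (_ : mkset _ = (`]0, 1] `*` `]0, 1]) `&` [set z : R * R | z.1 <= z.2]).
  by apply: measurable_fun_le => //; [exact: measurableX|
    exact: measurable_funTS measurable_fst|
    exact: measurable_funTS measurable_snd].
apply/seteqP; split => -[x y]/=; rewrite !in_itv/=.
  by move=> [x0 [xy y1]]; rewrite x0 y1 xy (lt_le_trans x0 xy) (le_trans xy y1).
by move=> [[/andP[x0 x1] /andP[y0 y1]] xy].
Qed.

Lemma logX_ge0 m u : u <= 1 -> 0 <= (- ln u) ^+ m.
Proof. by move=> u1; rewrite exprn_ge0// oppr_ge0 ln_le0. Qed.

Lemma measurable_logX m (D : set R) : measurable_fun D (fun u => (- ln u) ^+ m).
Proof.
by apply/measurable_funX/measurable_funTS/measurableT_comp.
Qed.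

(** Writing (- ln u) ^ (m + 1) as the integral over [u, 1] of its derivative and
    exchanging the integrals over the triangle 0 < u <= w <= 1 multiplies the
    m-th moment by (m + 1) / (N + 1).  The fundamental theorem of calculus thus
    meets the logarithm only away from its singularity at 0. *)
Lemma log_moment N m :
  (\int[mu]_(u in `]0%R, 1%R]) (u ^+ N * (- ln u) ^+ m)%:E =
   (m`!%:R / N.+1%:R ^+ m.+1)%:E)%E.
Proof.
elim: m => [|m IH].
  under eq_integral do rewrite expr0 mulr1.
  by rewrite integralXn// expr1n expr1.
pose g (z : R * R) := (z.1 ^+ N * (m.+1%:R * (- ln z.2) ^+ m / z.2))%:E.
pose T := [set z : R * R | 0 < z.1 /\ z.1 <= z.2 /\ z.2 <= 1].
have g0 z : T z -> (0 <= g z)%E.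
  case: z => u w [/= u0 [uw w1]]; have w0 := lt_le_trans u0 uw.
  by rewrite lee_fin mulr_ge0 ?exprn_ge0 ?divr_ge0 ?mulr_ge0 ?logX_ge0// ltW.
have mg : measurable_fun T g.
  apply/measurable_EFinP; apply: measurable_funM.
    apply: measurable_funX; apply: measurable_funTS; exact: measurable_fst.
  apply: measurable_funM; last first.
    apply: measurable_funV_pos; first exact: measurable_funTS measurable_snd.
    by move=> [u w] [/= u0 [uw _]]; exact: lt_le_trans uw.
  apply: measurable_funM; first exact: measurable_cst.
  apply/measurable_funTS.
  exact: (measurableT_comp (@measurable_logX m setT) measurable_snd).
transitivity (\int[mu]_(u in `]0%R, 1%R]) \int[mu]_(w in `[u, 1%R]) g (u, w))%E.
  apply: eq_integral => u /[!inE]/=; rewrite in_itv/= => /andP[u0 u1].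
  rewrite EFinM -integral_dlogX ?u0// -ge0_integralZl_EFin//.
  - move=> w /=; rewrite in_itv/= => /andP[uw w1].
    have w0 := lt_le_trans u0 uw.
    by rewrite lee_fin divr_ge0 ?mulr_ge0 ?logX_ge0// ltW.
  - apply/measurable_EFinP/measurable_funM.
      by apply: measurable_funM; [exact: measurable_cst|exact: measurable_logX].
    apply: measurable_funV_pos; first exact: measurable_id.
    by move=> w /=; rewrite in_itv/= => /andP[uw _]; exact: lt_le_trans uw.
  - by rewrite exprn_ge0// ltW.
rewrite -(@tonelli_region _ _ _ _ _ mu mu T g measurable_triangle mg
  g0); last first.
  move=> u w; rewrite /T/= !in_itv/=; split.
    by move=> [u0 [uw w1]]; rewrite u0 uw w1 (le_trans uw w1).
  by move=> [/andP[u0 u1] /andP[uw w1]].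
rewrite (@tonelli_region_swap _ _ _ _ _ mu mu T g measurable_triangle mg g0
  `]0%R, 1%R]%classic (fun w => `]0%R, w]%classic)); last first.
  move=> u w; rewrite /T/= !in_itv/=; split.
    by move=> [u0 [uw w1]]; rewrite u0 uw w1 (lt_le_trans u0 uw).
  by move=> [/andP[w0 w1] /andP[u0 uw]].
transitivity (\int[mu]_(w in `]0%R, 1%R])
    ((m.+1%:R / N.+1%:R)%:E * (w ^+ N * (- ln w) ^+ m)%:E))%E.
  apply: eq_integral => w /[!inE]/=; rewrite in_itv/= => /andP[w0 w1].
  rewrite /g/=; under eq_integral do rewrite mulrC EFinM.
  rewrite ge0_integralZl_EFin//; last 3 first.
  - by move=> u; rewrite /= in_itv/= => /andP[/ltW u0 _]; rewrite lee_fin exprn_ge0.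
  - by apply/measurable_EFinP; exact: exprn_measurable.
  - by rewrite divr_ge0 ?mulr_ge0 ?logX_ge0// ltW.
  rewrite integralXn ?ltW// -!EFinM; congr EFin.
  by rewrite exprS; field; rewrite nat1r pnatr_eq0 (gt_eqF w0).
rewrite ge0_integralZl_EFin//.
- rewrite IH -EFinM; congr EFin.
  by rewrite factS natrM [in RHS]exprS; field; rewrite nat1r ?expf_neq0 ?pnatr_eq0.
- move=> u; rewrite /= in_itv/= => /andP[/ltW u0 u1].
  by rewrite lee_fin mulr_ge0 ?logX_ge0 ?exprn_ge0.
- apply/measurable_EFinP/measurable_funM; last exact: measurable_logX.
  exact: exprn_measurable.
Qed.

End moments.

(** * Integral representation of the eta function *)

Section eta_function.
Context {R : realType}.
Local Notation mu := (@lebesgue_measure R).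
Implicit Types (N m : nat) (u w t : R).

Definition eta_integral N m : \bar R :=
  (\int[mu]_(u in `]0%R, 1%R]) (u ^+ N * (- ln u) ^+ m / (1 + u))%:E)%E.

Lemma measurable_XlogX N m (D : set R) :
  measurable_fun D (fun u => u ^+ N * (- ln u) ^+ m).
Proof.
by apply: measurable_funM; [exact: exprn_measurable|exact: measurable_logX].
Qed.

Lemma measurable_eta_integrand N m :
  measurable_fun (`]0%R, 1%R] : set R)
    (fun u => u ^+ N * (- ln u) ^+ m / (1 + u)).
Proof.
apply: measurable_funM; first exact: measurable_XlogX.
apply: measurable_funV_pos.
  by apply: measurable_funD; [exact: measurable_cst|exact: measurable_id].
by move=> u /=; rewrite in_itv/= => /andP[u0 _]; rewrite addr_gt0.
Qed.

Lemma eta_integrand_ge0 N m u : 0 < u <= 1 -> 0 <= u ^+ N * (- ln u) ^+ m / (1 + u).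
Proof.
move=> /andP[u0 u1].
by rewrite divr_ge0 ?mulr_ge0 ?logX_ge0 ?exprn_ge0 ?addr_ge0// ltW.
Qed.

(** The factor 1 + u cancels, which leaves a moment of the logarithm. *)
Lemma eta_integral_recurrence N m :
  (eta_integral N m + eta_integral N.+1 m = (m`!%:R / N.+1%:R ^+ m.+1)%:E)%E.
Proof.
rewrite /eta_integral -ge0_integralD//.
- rewrite -log_moment; apply: eq_integral => u /[!inE]/=.
  rewrite in_itv/= => /andP[u0 u1]; rewrite -EFinD; congr EFin.
  by rewrite exprS; field; rewrite gt_eqF// addr_gt0.
- by move=> u; rewrite /= in_itv/= lee_fin; exact: eta_integrand_ge0.
- by apply/measurable_EFinP; exact: measurable_eta_integrand.
- by move=> u; rewrite /= in_itv/= lee_fin; exact: eta_integrand_ge0.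
- by apply/measurable_EFinP; exact: measurable_eta_integrand.
Qed.

Lemma eta_integral_ge0 N m : (0 <= eta_integral N m)%E.
Proof.
by apply: integral_ge0 => u; rewrite /= in_itv/= lee_fin; exact: eta_integrand_ge0.
Qed.

Lemma eta_integral_le N m : (eta_integral N m <= (m`!%:R / N.+1%:R ^+ m.+1)%:E)%E.
Proof. by rewrite -eta_integral_recurrence leeDl// eta_integral_ge0. Qed.

Lemma eta_integral_fin_num N m : eta_integral N m \is a fin_num.
Proof.
rewrite ge0_fin_numE ?eta_integral_ge0//.
by rewrite (le_lt_trans (eta_integral_le N m)) ?ltry.
Qed.

(** Alternating telescoping of the recurrence. *)
Lemma eta_integral_partial_sum m n :
  \sum_(0 <= k < n) (-1) ^+ k * (m`!%:R / k.+1%:R ^+ m.+1) =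
  fine (eta_integral 0 m) - (-1) ^+ n * fine (eta_integral n m).
Proof.
elim: n => [|n IH]; first by rewrite big_nil mul1r subrr.
have rec : fine (eta_integral n m) + fine (eta_integral n.+1 m) =
    m`!%:R / n.+1%:R ^+ m.+1.
  by rewrite -fineD ?eta_integral_fin_num// eta_integral_recurrence.
by rewrite big_nat_recr//= IH -rec exprS; ring.
Qed.

Lemma eta_integral_cvg0 m : fine (eta_integral n m) @[n --> \oo] --> (0 : R).
Proof.
apply: (@squeeze_cvgr _ _ _ _ (cst 0) (fun n => m`!%:R * harmonic n)).
- near=> n; rewrite /= fine_ge0 ?eta_integral_ge0//=.
  rewrite -lee_fin fineK ?eta_integral_fin_num// (le_trans (eta_integral_le n m))//.
  rewrite lee_fin ler_pM2l ?ltr0n ?fact_gt0// lef_pV2 ?posrE ?exprn_gt0//.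
  by rewrite ler_eXnr// ler1n.
- exact: cvg_cst.
- rewrite -[X in _ --> X](mulr0 m`!%:R); apply: cvgM; first exact: cvg_cst.
  exact: cvg_harmonic.
Unshelve. all: by end_near. Qed.

Lemma eta_series m :
  (fun k : nat => (-1) ^+ k * riemannR (m.+1%:R : R) k) =
  (fun k : nat => (m`!%:R)^-1 * ((-1) ^+ k * (m`!%:R / k.+1%:R ^+ m.+1))).
Proof.
apply/funext => k; rewrite /riemannR powR_mulrn//; field.
by rewrite expf_neq0 ?pnatr_eq0//= -lt0n fact_gt0.
Qed.

Lemma cvg_eta_series m :
  series (fun k : nat => (-1) ^+ k * riemannR (m.+1%:R : R) k) @ \oo -->
    (m`!%:R)^-1 * fine (eta_integral 0 m).
Proof.
rewrite eta_series.
have -> : series (fun k : nat => (m`!%:R)^-1 *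
      ((-1) ^+ k * (m`!%:R / k.+1%:R ^+ m.+1))) =
    (fun n => (m`!%:R)^-1 *
      (fine (eta_integral 0 m) - (-1) ^+ n * fine (eta_integral n m))).
  by apply/funext => n; rewrite /series/= -mulr_sumr eta_integral_partial_sum.
apply: cvgM; first exact: cvg_cst.
have err0 : (-1) ^+ n * fine (eta_integral n m) @[n --> \oo] --> (0 : R).
  apply: norm_cvg0; under eq_fun do rewrite normrM normrX normrN1 expr1n mul1r.
  apply: cvg_trans (@eta_integral_cvg0 m); apply: near_eq_cvg; apply: nearW => n.
  by rewrite ger0_norm// fine_ge0// eta_integral_ge0.
have := cvgB (cvg_cst (fine (eta_integral 0 m))) err0.
by rewrite subr0; apply.
Qed.

Lemma eta_integralE m : eta_integral 0 m = (m`!%:R * eta (m.+1%:R : R))%:E.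
Proof.
rewrite /eta (cvg_lim _ (@cvg_eta_series m))// mulrA divff ?mul1r ?fineK//.
  exact: eta_integral_fin_num.
Qed.

Lemma eta_ge0 m : 0 <= eta (m.+1%:R : R).
Proof.
have := eta_integral_ge0 0 m; rewrite eta_integralE lee_fin pmulr_rge0//.
Qed.

Lemma is_cvg_eta_series m :
  series (fun k : nat => (-1) ^+ k * riemannR (m.+1%:R : R) k) @ \oo -->
  eta (m.+1%:R : R).
Proof.
by have := @cvg_eta_series m; rewrite eta_integralE/= mulKf.
Qed.

(** The eta integral for m = 0 is that of 1 / (1 + u), which is ln 2. *)
Lemma eta1 : eta (1 : R) = ln 2.
Proof.
apply: EFin_inj; have := eta_integralE 0; rewrite fact0 mul1r => <-.
rewrite /eta_integral.
transitivity (\int[mu]_(u in `]0%R, 1%R]) ((1 + u)^-1)%:E)%E.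
  by under eq_integral do rewrite !expr0 !mul1r.
have dF u : -1 < u -> is_derive u 1 (fun x : R => ln (1 + x)) ((1 + u)^-1).
  move=> u0; have u1 : 0 < 1 + u by lra.
  have dln := is_derive1_ln u1.
  have d1 : is_derive u 1 (fun x : R => 1 + x) 1.
    have -> : (fun x : R => 1 + x) = cst 1 + @id R by apply/funext.
    by apply: is_derive_eq; rewrite add0r.
  by rewrite -[X in is_derive _ _ _ X]mulr1; exact: is_derive1_comp.
have cF u : -1 < u -> {for u, continuous (fun x : R => ln (1 + x))}.
  by move=> /dF[df _]; apply/differentiable_continuous/derivable1_diffP.
rewrite integral_itv_obnd_cbnd; last first.
  apply/measurable_EFinP/measurable_funV_pos.
    by apply: measurable_funD; [exact: measurable_cst|exact: measurable_id].
  by move=> u /=; rewrite in_itv/= => /andP[u0 _]; rewrite addr_gt0.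
rewrite (@continuous_FTC2 _ _ (fun x : R => ln (1 + x)))//.
- by rewrite addr0 ln1 oppe0 adde0.
- apply: continuous_in_subspaceT => u /[!inE]/=; rewrite in_itv/= => /andP[u0 _].
  apply: cvgV; first by rewrite gt_eqF//; lra.
  by apply: cvgD; [exact: cvg_cst|exact: cvg_id].
- split.
  + by move=> u; rewrite in_itv/= => /andP[u0 _]; have [|] := dF u => //; lra.
  + by apply/cvg_at_right_filter/cF; lra.
  + by apply/cvg_at_left_filter/cF; lra.
- move=> u; rewrite in_itv/= => /andP[u0 _].
  by have [|_] := dF u; [lra|rewrite derive1E].
Qed.

End eta_function.

(** * From eta to zeta *)

Section eta_zeta.
Context {R : realType}.
Implicit Type m : nat.

Lemma powR2_expn m : (2 : R) `^ (1 - m.+2%:R) = (2 ^+ m.+1)^-1.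
Proof.
have -> : (1 - m.+2%:R : R) = - m.+1%:R by rewrite -natr1 opprD addrC subrK.
by rewrite powRN powR_mulrn.
Qed.

(** The even terms are counted with the wrong sign, and twice their sum up to
    2 n is 2 * 2 ^ (- s) times the partial sum of zeta up to n. *)
Lemma eta_zeta_partial m n :
  series (fun k : nat => (-1) ^+ k * riemannR (m.+2%:R : R) k) (2 * n)%N =
  series (riemannR (m.+2%:R : R)) (2 * n)%N -
  2 `^ (1 - m.+2%:R) * series (riemannR (m.+2%:R : R)) n.
Proof.
elim: n => [|n IH]; first by rewrite muln0 /series/= !big_geq//; ring.
have even2n : (-1 : R) ^+ (2 * n)%N = 1 by rewrite exprM sqrrN expr1n expr1n.
have double : riemannR (m.+2%:R : R) (2 * n).+1 =
    (2 ^+ m.+2)^-1 * riemannR (m.+2%:R : R) n.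
  rewrite /riemannR !powR_mulrn// -invfM -exprMn -natrM; congr (_%:R ^+ _)^-1.
  by rewrite mulnS.
rewrite mulnS add2n !seriesSr IH exprS even2n double powR2_expn [2 ^+ m.+2]exprS.
by field; rewrite expf_neq0.
Qed.

(** With Z_n the partial sums of zeta and q = 2 ^ (1 - s) < 1, the previous lemma
    gives Z_n <= Z_2n <= M + q * Z_n, where M bounds the partial sums of the
    convergent eta series; so Z_n <= M / (1 - q). *)
Lemma is_cvg_zeta_series m : cvgn (series (riemannR (m.+2%:R : R))).
Proof.
have nd : nondecreasing_seq (series (riemannR (m.+2%:R : R))).
  apply/nondecreasing_seqP => n; rewrite seriesSr lerDl ltW//.
  exact: riemannR_gt0.
apply: nondecreasing_is_cvgn => //.
have [M uM] := bounded_fun_has_ubound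
  (cvg_seq_bounded (cvgP _ (@is_cvg_eta_series R m.+1))).
set q : R := 2 `^ (1 - m.+2%:R).
have q1 : q < 1.
  by rewrite /q powR2_expn invf_lt1 ?exprn_gt0// exprn_egt1// ltr1n.
exists (M / (1 - q)) => _ [n _ <-].
rewrite ler_pdivlMr ?subr_gt0//.
have Z2n : series (riemannR (m.+2%:R : R)) n <=
    series (riemannR (m.+2%:R : R)) (2 * n)%N.
  by apply: nd; rewrite mul2n -addnn leq_addr.
have AM := uM _ (ex_intro2 _ _ (2 * n)%N I erefl).
by move: AM; rewrite /= eta_zeta_partial -/q; nra.
Qed.

Lemma eta_zeta m :
  eta (m.+2%:R : R) = (1 - 2 `^ (1 - m.+2%:R)) * zeta (m.+2%:R : R).
Proof.
have m2 : muln 2 @ \oo --> \oo by exact: cvg_mulnl.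
have cA := cvg_comp _ _ m2 (@is_cvg_eta_series R m.+1).
have cZ := cvg_comp _ _ m2 (@is_cvg_zeta_series m).
have cB := cvgB cZ (cvgM (cvg_cst (2 `^ (1 - m.+2%:R))) (@is_cvg_zeta_series m)).
rewrite mulrBl mul1r -(cvg_lim _ cA)//; apply: cvg_lim => //.
rewrite (_ : _ \o _ = fun n : nat =>
  series (riemannR (m.+2%:R : R)) (2 * n)%N -
  2 `^ (1 - m.+2%:R) * series (riemannR (m.+2%:R : R)) n); first exact: cB.
by apply/funext => n; exact: eta_zeta_partial.
Qed.

End eta_zeta.

(** * Complete homogeneous polynomials in two variables *)

Section hsym.
Context {R : realType}.
Implicit Types (n : nat) (x y s v : R).

Lemma hsymE n x y : hsym n x y = \sum_(a < n.+1) x ^+ a * y ^+ (n - a).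
Proof.
apply: eq_bigr => a _; rewrite (big_pred1 (rev_ord a)) => [|b].
  by rewrite /= subSS.
have an : (a <= n)%N by rewrite -ltnS.
rewrite /= -val_eqE/= subSS; apply/eqP/eqP => [ab|->]; last by rewrite subnKC.
by rewrite -[b : nat](addKn a) ab.
Qed.

Lemma hsymC n x y : hsym n x y = hsym n y x.
Proof.
rewrite !hsymE (reindex_inj rev_ord_inj)/=; apply: eq_bigr => a _.
by rewrite subSS subKn 1?mulrC// -ltnS.
Qed.

Lemma hsymN n x y : hsym n (- x) (- y) = (-1) ^+ n * hsym n x y.
Proof.
rewrite !hsymE mulr_sumr; apply: eq_bigr => a _.
rewrite [(- x) ^+ _]exprNn [(- y) ^+ _]exprNn mulrACA -exprD subnKC//.
by rewrite -ltnS.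
Qed.

Lemma hsym_ge0 n x y : 0 <= x -> 0 <= y -> 0 <= hsym n x y.
Proof.
by move=> x0 y0; rewrite hsymE sumr_ge0// => a _; rewrite mulr_ge0// exprn_ge0.
Qed.

Lemma hsymS n x y : hsym n.+1 x y = y ^+ n.+1 + x * hsym n x y.
Proof.
rewrite !hsymE big_ord_recl/= mul1r subn0 mulr_sumr; congr (_ + _).
by apply: eq_bigr => a _; rewrite /bump/= add1n subSS exprS mulrA.
Qed.

(** This is ((s + v) ^ (n + 1) - s ^ (n + 1)) / v expanded by the binomial
    theorem; the induction with Pascal's rule also covers v = 0. *)
Lemma hsymDr n s v : hsym n s (s + v) =
  \sum_(k < n.+1) 'C(n.+1, k.+1)%:R * s ^+ (n - k) * v ^+ k.
Proof.
elim: n => [|n IH].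
  by rewrite hsymE !big_ord1 binn !expr0 !mulr1.
rewrite hsymS IH exprDn big_ord_recr/= [in RHS]big_ord_recr/=.
rewrite subnn !binn !expr0 mulr_sumr addrAC.
congr (_ + _); last by rewrite mulr1n !mul1r.
rewrite -big_split/=; apply: eq_bigr => k _.
have kn : (k <= n)%N by rewrite -ltnS.
rewrite [in RHS]binS natrD subSn// exprS -mulr_natl; ring.
Qed.

End hsym.

(** * The double integral *)

Section double.
Context {R : realType}.
Local Notation mu := (@lebesgue_measure R).
Implicit Types (n : nat) (u x y : R).

(** The integrand of E2 with logarithms replaced by their opposites, which
    absorbs the sign (-1) ^ n and makes it nonnegative on the square. *)
Definition kernel2 n (t : R * R) : R := hsym n (- ln t.1) (- ln t.2) / (t.1 + t.2).

Lemma kernel2_ge0 n x y : 0 < x <= 1 -> 0 < y <= 1 -> 0 <= kernel2 n (x, y).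
Proof.
move=> /andP[x0 x1] /andP[y0 y1].
by rewrite divr_ge0 ?addr_ge0 ?(ltW x0) ?(ltW y0)// hsym_ge0 ?oppr_ge0 ?ln_le0.
Qed.

Lemma measurable_kernel2 n (D : set (R * R)) :
  D `<=` [set` `]0, 1]] `*` [set` `]0, 1]] -> measurable_fun D (kernel2 n).
Proof.
move=> Dsub; apply: measurable_funM.
  have -> : (fun t : R * R => hsym n (- ln t.1) (- ln t.2)) =
      (fun t => \sum_(a < n.+1) (- ln t.1) ^+ a * (- ln t.2) ^+ (n - a)).
    by apply/funext => t; rewrite hsymE.
  apply: measurable_sum => a; apply: measurable_funM; apply: measurable_funTS.
  - exact: (measurableT_comp (@measurable_logX R a setT) measurable_fst).
  - exact: (measurableT_comp (@measurable_logX R (n - a) setT) measurable_snd).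
apply: measurable_funV_pos.
  by apply: measurable_funD; apply: measurable_funTS;
    [exact: measurable_fst|exact: measurable_snd].
move=> [x y] /Dsub[]/=; rewrite !in_itv/= => /andP[x0 _] /andP[y0 _].
exact: addr_gt0.
Qed.

Lemma measurable_ray n x (h : R -> R) (D : set R) : 0 < x <= 1 ->
  measurable D -> measurable_fun setT h -> (forall u, D u -> 0 < h u <= 1) ->
  measurable_fun D (fun u => kernel2 n (x, h u)).
Proof.
move=> x01 mD mh h01.
have -> : (fun u => kernel2 n (x, h u)) = kernel2 n \o (fun u => (x, h u)) by [].
refine (measurable_comp
  (F := ([set` `]0, 1]] `*` [set` `]0, 1]] : set (R * R))) _ _ _ _).
- by apply: measurableX.
- by move=> _ [u Du <-]; rewrite /= !in_itv/= x01 h01.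
- exact: measurable_kernel2.
- by apply/measurable_funTS/measurable_fun_pair; [exact: measurable_cst|].
Qed.

(** Rescaling y = x * u makes the integrand a polynomial in - ln x whose
    coefficients are eta integrals. *)
Lemma integral_ray n x : 0 < x <= 1 ->
  (\int[mu]_(y in `]0%R, x]) (kernel2 n (x, y))%:E =
   (\sum_(k < n.+1) 'C(n.+1, k.+1)%:R * k`!%:R * eta (k.+1%:R : R) *
      (- ln x) ^+ (n - k))%:E)%E.
Proof.
move=> /andP[x0 x1].
have mgx : measurable_fun `]0, x] (fun y => (kernel2 n (x, y))%:E).
  apply/measurable_EFinP; apply: (@measurable_ray n x id) => //.
    by rewrite x0 x1.
  move=> y /=; rewrite in_itv/= => /andP[y0 yx].
  by rewrite y0 (le_trans yx x1).
rewrite integral_dilation//; last first.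
  move=> y /andP[y0 yx]; rewrite lee_fin kernel2_ge0// ?x0 ?y0//.
  exact: le_trans x1.
rewrite -ge0_integralZl_EFin//; last 3 first.
- move=> u; rewrite /= in_itv/= => /andP[u0 u1]; rewrite lee_fin.
  rewrite kernel2_ge0 ?x0// mulr_gt0//=.
  by rewrite mulr_ile1// ltW.
- apply/measurable_EFinP; apply: (@measurable_ray n x (fun u => x * u)) => //.
  + by rewrite x0.
  + exact: mulrl_measurable.
  + move=> u /=; rewrite in_itv/= => /andP[u0 u1].
    by rewrite mulr_gt0//= mulr_ile1// ltW.
- exact: ltW.
transitivity (\int[mu]_(u in `]0%R, 1%R]) \sum_(k < n.+1)
   (('C(n.+1, k.+1)%:R * (- ln x) ^+ (n - k))%:E *
     (u ^+ 0 * (- ln u) ^+ k / (1 + u))%:E))%E.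
  apply: eq_integral => u /[!inE]/=; rewrite in_itv/= => /andP[u0 u1].
  rewrite -EFinM; under eq_bigr do rewrite -EFinM.
  rewrite sumEFin; congr EFin; rewrite /kernel2/= lnM ?posrE// opprD hsymDr.
  rewrite mulr_suml mulr_sumr; apply: eq_bigr => k _; field.
  by rewrite !gt_eqF// addr_gt0// mulr_gt0.
have cge0 k : 0 <= 'C(n.+1, k.+1)%:R * (- ln x) ^+ (n - k).
  by rewrite mulr_ge0// logX_ge0.
rewrite ge0_integral_sum//; last 2 first.
- move=> k; apply/measurable_EFinP/measurable_funM; first exact: measurable_cst.
  exact: measurable_eta_integrand.
- move=> k u; rewrite /= in_itv/= => u01; rewrite -EFinM lee_fin mulr_ge0//.
  exact: eta_integrand_ge0.
rewrite -sumEFin; apply: eq_bigr => k _.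
rewrite ge0_integralZl_EFin//; last 2 first.
- by move=> u; rewrite /= in_itv/= => u01; rewrite lee_fin;
    exact: eta_integrand_ge0.
- by apply/measurable_EFinP; exact: measurable_eta_integrand.
rewrite -/(eta_integral 0 k) eta_integralE -EFinM; congr EFin; ring.
Qed.

Lemma integral_triangle n :
  (\int[mu]_(x in `]0%R, 1%R]) \int[mu]_(y in `]0%R, x]) (kernel2 n (x, y))%:E =
   ((n.+1)`!%:R * \sum_(1 <= j < n.+2) (eta (j%:R : R) / j%:R))%:E)%E.
Proof.
pose c k : R := 'C(n.+1, k.+1)%:R * k`!%:R * eta (k.+1%:R : R).
have c0 k : 0 <= c k by rewrite mulr_ge0 ?eta_ge0.
transitivity (\int[mu]_(x in `]0%R, 1%R]) \sum_(k < n.+1)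
    ((c k)%:E * (x ^+ 0 * (- ln x) ^+ (n - k))%:E))%E.
  apply: eq_integral => x /[!inE]/=; rewrite in_itv/= => x01.
  rewrite integral_ray// -sumEFin; apply: eq_bigr => k _.
  by rewrite -EFinM expr0 mul1r.
have lx0 k x : 0 < x <= 1 -> 0 <= x ^+ 0 * (- ln x) ^+ (n - k).
  by move=> /andP[_ x1]; rewrite mul1r logX_ge0.
rewrite ge0_integral_sum//; last 2 first.
- move=> k; apply/measurable_EFinP/measurable_funM; first exact: measurable_cst.
  exact: measurable_XlogX.
- move=> k x; rewrite /= in_itv/= => x01.
  by rewrite -EFinM lee_fin mulr_ge0// lx0.
rewrite big_add1/= big_mkord mulr_sumr -sumEFin; apply: eq_bigr => k _.
rewrite ge0_integralZl_EFin//; last 2 first.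
- by move=> x; rewrite /= in_itv/= => x01; rewrite lee_fin lx0.
- by apply/measurable_EFinP; exact: measurable_XlogX.
rewrite log_moment expr1n divr1 -EFinM; congr EFin.
have kn : (k.+1 <= n.+1)%N by exact: ltn_ord.
rewrite /c -(bin_fact kn) subSS factS !natrM; field.
by rewrite nat1r pnatr_eq0.
Qed.

(** The two triangles are integrated in opposite orders, so that the symmetry of
    the kernel identifies the resulting iterated integrals. *)
Lemma integral_square n :
  (\int[(mu \x mu)%E]_(t in [set` `]0%R, 1%R]] `*` [set` `]0%R, 1%R]])
     (kernel2 n t)%:E =
   (2 * (n.+1)`!%:R * \sum_(1 <= j < n.+2) (eta (j%:R : R) / j%:R))%:E)%E.
Proof.
pose Q : set (R * R) := [set` `]0, 1]] `*` [set` `]0, 1]].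
pose D : set (R * R) := Q `&` [set t | t.2 <= t.1].
have mQ : measurable Q by exact: measurableX.
have mD : measurable D.
  apply: measurable_fun_le => //.
    exact: measurable_funTS measurable_snd.
  exact: measurable_funTS measurable_fst.
have mg (A : set (R * R)) : A `<=` Q ->
    measurable_fun A (fun t => (kernel2 n t)%:E).
  by move=> AQ; apply/measurable_EFinP; exact: measurable_kernel2.
have g0 (A : set (R * R)) : A `<=` Q -> forall t, A t -> (0 <= (kernel2 n t)%:E)%E.
  move=> AQ [x y] /AQ[]/=; rewrite !in_itv/= => x01 y01.
  by rewrite lee_fin kernel2_ge0.
have DQ : D `<=` Q by move=> t [].
have DcQ : Q `\` D `<=` Q by move=> t [].
have mDc : measurable (Q `\` D) by exact: measurableD.
have -> : [set` `]0%R, 1%R]] `*` [set` `]0%R, 1%R]] = D `|` (Q `\` D).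
  by rewrite setDUK.
rewrite ge0_integral_setU//; first last.
- by apply/disj_setPS => t [Dt [_]].
- by move=> t; rewrite setDUK//; exact: (g0 _ (@subset_refl _ Q)).
- by rewrite setDUK//; exact: mg.
rewrite (@tonelli_region _ _ _ _ _ mu mu D _ mD (mg _ DQ) (g0 _ DQ)
  `]0%R, 1%R]%classic (fun x => `]0%R, x]%classic)); last first.
  move=> x y; rewrite /D/Q/= !in_itv/=; split.
    by move=> [[-> /andP[-> _]] ->].
  by move=> [/andP[x0 x1] /andP[y0 yx]]; rewrite x0 x1 y0 yx (le_trans yx x1).
rewrite (@tonelli_region_swap _ _ _ _ _ mu mu _ _ mDc (mg _ DcQ) (g0 _ DcQ)
  `]0%R, 1%R]%classic (fun y => `]0%R, y[%classic)); last first.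
  move=> x y; rewrite /D/Q/= !in_itv/=; split.
    move=> [[/andP[x0 x1] /andP[y0 y1]] nyx]; rewrite y0 y1 x0; split => //=.
    by rewrite ltNge; apply/negP => yx; apply: nyx; rewrite x0 x1 y0 y1.
  move=> [/andP[y0 y1] /andP[x0 xy]]; rewrite x0 y0 y1 (le_trans (ltW xy) y1).
  by split => // -[_]; rewrite leNgt xy.
rewrite integral_triangle.
rewrite [X in (_ + X)%E](_ : _ = \int[mu]_(x in `]0%R, 1%R])
    \int[mu]_(y in `]0%R, x]) (kernel2 n (x, y))%:E)%E; last first.
  apply: eq_integral => y /[!inE]/=; rewrite in_itv/= => /andP[y0 y1].
  under eq_integral do rewrite /kernel2/= hsymC addrC.
  (* The diagonal belongs to one triangle only, but is negligible. *)
  rewrite integral_itv_bndo_bndc//.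
  apply/measurable_EFinP; apply: (@measurable_ray n y id) => //.
    by rewrite y0 y1.
  move=> x /=; rewrite in_itv/= => /andP[x0 xy].
  by rewrite x0 (le_trans (ltW xy) y1).
by rewrite integral_triangle -EFinD; congr EFin; ring.
Qed.

Lemma E2_eta n : E2 R n =
  (2 * (n.+1)`!%:R * \sum_(1 <= j < n.+2) (eta (j%:R : R) / j%:R))%:E.
Proof.
rewrite -integral_square /E2.
have gE t : hsym n (ln t.1) (ln t.2) / (t.1 + t.2) = (-1) ^+ n * kernel2 n t.
  by rewrite /kernel2 hsymN mulrA mulrA -expr2 sqrr_sign mul1r.
under eq_integral do rewrite gE.
(* For odd n the integrand is nonpositive: its integral is the opposite of that
   of the kernel, even before finiteness is known. *)
rewrite -signr_odd; case: (odd n); last first.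
  by rewrite expr0 mul1e; apply: eq_integral => t _; rewrite mul1r.
rewrite expr1; under eq_integral do rewrite mulN1r EFinN.
rewrite integral_ge0N; first by rewrite EFinN mulN1e oppeK.
move=> [x y] /= []; rewrite !in_itv/= => x01 y01.
by rewrite lee_fin kernel2_ge0.
Qed.

End double.

Theorem theorem3 (R : realType) (n : nat) :
  E2 R n =
    (2 * (n.+1)`!%:R * \sum_(1 <= j < n.+2) (eta (j%:R : R) / j%:R))%:E /\
  E2 R n =
    (2 * (n.+1)`!%:R *
      (ln (2 : R) +
       \sum_(2 <= j < n.+2)
          ((1 - 2 `^ (1 - j%:R)) * zeta (j%:R : R) / j%:R)))%:E.
Proof.
split; first exact: E2_eta.
rewrite E2_eta; congr (_ * _)%:E.
rewrite big_ltn// eta1 divr1; congr (_ + _).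
rewrite [LHS]big_nat_cond [RHS]big_nat_cond; apply: eq_bigr => j.
by case: j => [|[|j]]//= _; rewrite eta_zeta.
Qed.
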